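(* Let $A$ be a finite simple algebra over a field $\mathbf F$, let $\mathfrak V=\operatorname{var}A$, and let $\mathfrak U$ be the variety generated by all proper subalgebras of $A$. (i) Every finite algebra $C\in\mathfrak V$ is a direct sum of two ideals $C=P\oplus Q$, where $P$ is isomorphic to a finite direct power of $A$ (possibly zero) and $Q\in\mathfrak U$. (ii) If $F$ is a free algebra of (finite) rank $n$ in $\mathfrak V$, then $F=P\oplus Q$ (direct sum of ideals), where $P$ is isomorphic to a direct power of $A$ and $Q$ is a $\mathfrak U$-free algebra of rank $n$.
   Context: An algebra over a field $\mathbf F$ is a vector space over $\mathbf F$ with a bilinear multiplication (not assumed associative, commutative or unital). A nonzero algebra is simple if it has no proper nonzero two-sided ideals (so the one-dimensional algebra with zero multiplication is allowed). For a set $\mathcal S$ of $\mathbf F$-algebras, the variety generated by $\mathcal S$, $\operatorname{var}\mathcal S$, is the class of all $\mathbf F$-algebras satisfying every identity $v(x_1,\dots,x_n)=0$ that holds in all algebras of $\mathcal S$, where $v$ ranges over nonassociative polynomials over $\mathbf F$ without constant term; $\operatorname{var}A=\operatorname{var}\{A\}$. The trivial variety consists of the zero algebra only. The free algebra of rank $n$ in a variety $\mathfrak W$ ($\mathfrak W$-free algebra of rank $n$) is the quotient of the absolutely free nonassociative algebra on $x_1,\dots,x_n$ by the ideal of all polynomials $v(x_1,\dots,x_n)$ such that $v=0$ is an identity of $\mathfrak W$ (it is zero if $\mathfrak W$ is trivial). *)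

(* Defs.v *)
From HB Require Import structures.
From mathcomp Require Import all_boot all_order all_algebra.
From mathcomp Require Import generic_quotient ring_quotient sesquilinear.
From mathcomp Require Import finmap.
From mathcomp Require Import boolp classical_sets functions cardinality.
From mathcomp Require Import monalg.

Set Implicit Arguments.
Unset Strict Implicit.
Unset Printing Implicit Defensive.

Import GRing.Theory.
Local Open Scope ring_scope.
Local Open Scope quotient_scope.

(* Algebras that need not be associative, commutative or unital; the ring     *)
(* hierarchy of the library has no such structure.                            *)

HB.mixin Record Lmodule_isNalgebra (F : fieldType) (A : Type)
    of GRing.Lmodule F A := {
  amul : A -> A -> A;
  amul_bilinear : bilinear_for *:%R *:%R amul
}.

#[short(type="nalgType")]
HB.structure Definition Nalgebra (F : fieldType) :=
  {A of Lmodule_isNalgebra F A & GRing.Lmodule F A}.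

Notation "x *a y" := (amul x y)
  (at level 40, left associativity) : ring_scope.

HB.instance Definition _ (F : fieldType) (A : nalgType F) :=
  bilinear_isBilinear.Build F A A A *:%R *:%R (@amul F A)
    (@amul_bilinear F A).

Definition alg_iso (F : fieldType) (A B : nalgType F) : Prop :=
  exists f : {linear A -> B},
    bijective f /\ {morph f : x y / x *a y >-> x *a y}.

Definition finite_alg (F : fieldType) (A : nalgType F) : Prop :=
  finite_set [set: A].

Record subalg (F : fieldType) (A : nalgType F) := Subalg {
  subalg_pred :> {pred A};
  subalg_submod : submod_closed subalg_pred;
  subalg_amul : {in subalg_pred &, forall x y, x *a y \in subalg_pred}
}.

Record ideal (F : fieldType) (A : nalgType F) := Ideal {
  ideal_pred : {pred A};
  ideal_submod : submod_closed ideal_pred;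
  ideal_amull : forall x, {in ideal_pred, forall y, x *a y \in ideal_pred};
  ideal_amulr : forall y, {in ideal_pred, forall x, x *a y \in ideal_pred}
}.

Section Subalgebras.
Variables (F : fieldType) (A : nalgType F).

Fact ideal_amul (I : ideal A) :
  {in ideal_pred I &, forall x y, x *a y \in ideal_pred I}.
Proof. by move=> x y _ yI; apply: ideal_amull. Qed.

Definition ideal_subalg (I : ideal A) : subalg A :=
  Subalg (@ideal_submod _ _ I) (@ideal_amul I).

HB.instance Definition _ (S : subalg A) :=
  GRing.isSubmodClosed.Build F A (subalg_pred S) (subalg_submod S).

Record subalg_type (S : subalg A) :=
  SubalgElt { subalg_val : A; _ : subalg_val \in S }.

Section SubalgType.
Variable S : subalg A.
HB.instance Definition _ := [isSub for @subalg_val S].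
HB.instance Definition _ := [Choice of subalg_type S by <:].
HB.instance Definition _ :=
  GRing.SubChoice_isSubLmodule.Build F A (subalg_pred S) (subalg_type S)
    (subalg_submod S).

Fact subalg_mul_subproof (u v : subalg_type S) : val u *a val v \in S.
Proof. by apply: subalg_amul; apply: valP. Qed.

Definition subalg_mul (u v : subalg_type S) : subalg_type S :=
  SubalgElt (subalg_mul_subproof u v).

Fact subalg_mul_bilinear : bilinear_for *:%R *:%R subalg_mul.
Proof.
by split=> z c x y; apply: val_inj; rewrite /= (linearPl, linearPr).
Qed.

HB.instance Definition _ :=
  Lmodule_isNalgebra.Build F (subalg_type S) subalg_mul_bilinear.
End SubalgType.

End Subalgebras.

Coercion ideal_subalg : ideal >-> subalg.

Definition proper_subalg (F : fieldType) (A : nalgType F) (S : subalg A) : Prop :=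
  exists x : A, x \notin S.

Definition simple_alg (F : fieldType) (A : nalgType F) : Prop :=
  (exists x : A, x != 0) /\
  forall I : ideal A, proper_subalg I -> forall x, x \in I -> x = 0.

Definition is_direct_sum (F : fieldType) (A : nalgType F) (P Q : ideal A) :=
  (forall x : A, exists p q : A, [/\ p \in P, q \in Q & x = p + q]) /\
  (forall x : A, x \in P -> x \in Q -> x = 0).

Section QuotientAlgebra.
Variables (F : fieldType) (A : nalgType F) (I : ideal A).

Definition quot_alg : Type := Quotient.quot (subalg_pred I).

HB.instance Definition _ := ZmodQuotient.on quot_alg.

Definition quot_scale (c : F) : quot_alg -> quot_alg :=
  lift_op1 quot_alg ( *:%R c).

Definition quot_mul : quot_alg -> quot_alg -> quot_alg :=
  lift_op2 quot_alg (@amul F A).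

Fact quot_eqP (x y : A) :
  reflect (\pi_quot_alg x = \pi_quot_alg y) (x - y \in subalg_pred I).
Proof. by rewrite Quotient.idealrBE; apply: eqP. Qed.

Fact pi_quot_scale c : {morph \pi_quot_alg : x / c *: x >-> quot_scale c x}.
Proof.
move=> x; unlock quot_scale; apply/quot_eqP.
by rewrite -scalerBr rpredZ //; apply/quot_eqP; rewrite reprK.
Qed.

Fact pi_quot_mul : {morph \pi_quot_alg : x y / x *a y >-> quot_mul x y}.
Proof.
move=> x y; unlock quot_mul; apply/quot_eqP.
set x' := repr _; set y' := repr _.
rewrite -[X in X - _](subrK (x *a y')) -addrA -linearBr -linearBl.
apply: rpredD; [apply: ideal_amull | apply: ideal_amulr];
  by apply/quot_eqP; rewrite reprK.
Qed.

Let piD : {morph \pi_quot_alg : x y / x + y}.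
Proof. exact: raddfD. Qed.

Fact quot_scaleA a b v : quot_scale a (quot_scale b v) = quot_scale (a * b) v.
Proof. by rewrite -[v]reprK -!pi_quot_scale scalerA. Qed.

Fact quot_scale1 : left_id 1 quot_scale.
Proof. by move=> v; rewrite -[v]reprK -pi_quot_scale scale1r. Qed.

Fact quot_scaleDr : right_distributive quot_scale +%R.
Proof.
move=> a u v; rewrite -[u]reprK -[v]reprK.
by rewrite -!pi_quot_scale -!piD -pi_quot_scale scalerDr.
Qed.

Fact quot_scaleDl v : {morph quot_scale^~ v : a b / a + b}.
Proof.
by move=> a b; rewrite -[v]reprK -!pi_quot_scale -piD scalerDl.
Qed.

HB.instance Definition _ := GRing.Zmodule_isLmodule.Build F quot_alg
  quot_scaleA quot_scale1 quot_scaleDr quot_scaleDl.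

Fact quot_mul_bilinear : bilinear_for *:%R *:%R quot_mul.
Proof.
have piP c (x y : A) :
    c *: \pi_quot_alg x + \pi_quot_alg y = \pi_quot_alg (c *: x + y).
  by rewrite piD pi_quot_scale.
split=> w c u v; rewrite -[u]reprK -[v]reprK -[w]reprK piP -!pi_quot_mul piP.
  by rewrite linearPl.
by rewrite linearPr.
Qed.

HB.instance Definition _ :=
  Lmodule_isNalgebra.Build F quot_alg quot_mul_bilinear.

End QuotientAlgebra.

Section Power.
Variables (F : fieldType) (A : nalgType F) (I : Type).

Definition power : Type := I -> A.

HB.instance Definition _ := GRing.Lmodule.on power.

Definition power_mul (u v : power) : power := fun i => u i *a v i.

Fact power_mul_bilinear : bilinear_for *:%R *:%R power_mul.
Proof.
by split=> w c u v; apply/funext=> i; [exact: linearPl | exact: linearPr].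
Qed.

HB.instance Definition _ :=
  Lmodule_isNalgebra.Build F power power_mul_bilinear.

End Power.

(* Nonassociative monomials of degree at least 1 in n variables: the free     *)
(* magma on 'I_n. As there is no empty monomial, polynomials have no constant *)
(* term.                                                                      *)

Inductive magma (n : nat) : Type :=
  | MVar of 'I_n
  | MMul of magma n & magma n.

Section MagmaChoice.
Variable n : nat.

Fixpoint magma_encode (m : magma n) : GenTree.tree 'I_n :=
  match m with
  | MVar i => GenTree.Leaf i
  | MMul m1 m2 => GenTree.Node 0 [:: magma_encode m1; magma_encode m2]
  end.

Fixpoint magma_decode (t : GenTree.tree 'I_n) : option (magma n) :=
  match t with
  | GenTree.Leaf i => Some (MVar i)
  | GenTree.Node _ [:: t1; t2] =>
      if magma_decode t1 is Some m1 then
        if magma_decode t2 is Some m2 then Some (MMul m1 m2) else None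
      else None
  | _ => None
  end.

Fact magma_encodeK : pcancel magma_encode magma_decode.
Proof. by elim=> [i //|m1 IH1 m2 IH2] /=; rewrite IH1 IH2. Qed.

HB.instance Definition _ := Countable.copy (magma n) (pcan_type magma_encodeK).

End MagmaChoice.

(* The absolutely free nonassociative algebra: finitely supported functions   *)
(* on monomials, with the multiplication extending MMul bilinearly.           *)

Section Polynomials.
Variables (F : fieldType) (n : nat).

Definition napoly : Type := {malg F[magma n]}.

HB.instance Definition _ := GRing.Lmodule.on napoly.

Definition napoly_mul (u v : napoly) : napoly :=
  \sum_(k <- msupp u) \sum_(l <- msupp v) << u@_k * v@_l *g MMul k l >>.

Fact napoly_mulw (d e : {fset magma n}) (u v : napoly) :
  fsubset (msupp u) d -> fsubset (msupp v) e ->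
  napoly_mul u v =
  \sum_(k <- d) \sum_(l <- e) << u@_k * v@_l *g MMul k l >>.
Proof.
move=> ud ve; rewrite /napoly_mul (big_fset_incl _ ud) /=.
  apply: eq_bigr => k _; apply: big_fset_incl => // l _ /mcoeff_outdom ->.
  by rewrite mulr0 monalgU0.
by move=> k _ /mcoeff_outdom uk; rewrite big1 // => l _; rewrite uk mul0r monalgU0.
Qed.

Fact monalgUZ (c a : F) (k : magma n) : << c * a *g k >> = c *: << a *g k >>.
Proof. by apply/malgP=> l; rewrite mcoeffZ !mcoeffU mulrnAr. Qed.

Fact napoly_mul_bilinear : bilinear_for *:%R *:%R napoly_mul.
Proof.
split=> w c u v /=.
  pose d := fsetU (fsetU (msupp u) (msupp v)) (msupp (c *: u + v)).
  have [ud vd cd] : [/\ fsubset (msupp u) d, fsubset (msupp v) d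
                     & fsubset (msupp (c *: u + v)) d].
    by split; apply/fsubsetP=> x xu; rewrite !inE xu ?orbT.
  rewrite (napoly_mulw ud (fsubset_refl _)) (napoly_mulw vd (fsubset_refl _)).
  rewrite (napoly_mulw cd (fsubset_refl _)) scaler_sumr -big_split /=.
  apply: eq_bigr => k _; rewrite scaler_sumr -big_split /=.
  apply: eq_bigr => l _.
  by rewrite mcoeffD mcoeffZ mulrDl monalgUD -mulrA (monalgUZ c).
pose d := fsetU (fsetU (msupp u) (msupp v)) (msupp (c *: u + v)).
have [ud vd cd] : [/\ fsubset (msupp u) d, fsubset (msupp v) d
                   & fsubset (msupp (c *: u + v)) d].
  by split; apply/fsubsetP=> x xu; rewrite !inE xu ?orbT.
rewrite (napoly_mulw (fsubset_refl _) ud) (napoly_mulw (fsubset_refl _) vd).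
rewrite (napoly_mulw (fsubset_refl _) cd) scaler_sumr -big_split /=.
apply: eq_bigr => k _; rewrite scaler_sumr -big_split /=.
apply: eq_bigr => l _.
by rewrite mcoeffD mcoeffZ mulrDr monalgUD mulrCA (monalgUZ c).
Qed.

HB.instance Definition _ :=
  Lmodule_isNalgebra.Build F napoly napoly_mul_bilinear.

End Polynomials.

Section Evaluation.
Variables (F : fieldType) (n : nat) (A : nalgType F) (h : 'I_n -> A).

Fixpoint magma_eval (m : magma n) : A :=
  match m with
  | MVar i => h i
  | MMul k l => magma_eval k *a magma_eval l
  end.

Definition napoly_eval (v : napoly F n) : A :=
  \sum_(m <- msupp v) v@_m *: magma_eval m.

Fact napoly_evalw (d : {fset magma n}) (v : napoly F n) :
  fsubset (msupp v) d -> napoly_eval v = \sum_(m <- d) v@_m *: magma_eval m.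
Proof.
move=> vd; apply: big_fset_incl => // k _ /mcoeff_outdom ->.
by rewrite scale0r.
Qed.

Fact napoly_eval_linear : linear napoly_eval.
Proof.
move=> c u v.
pose d := fsetU (fsetU (msupp u) (msupp v)) (msupp (c *: u + v)).
have [ud vd cd] : [/\ fsubset (msupp u) d, fsubset (msupp v) d
                   & fsubset (msupp (c *: u + v)) d].
  by split; apply/fsubsetP=> x xu; rewrite !inE xu ?orbT.
rewrite (napoly_evalw ud) (napoly_evalw vd) (napoly_evalw cd).
rewrite scaler_sumr -big_split /=; apply: eq_bigr => k _.
by rewrite mcoeffD mcoeffZ scalerDl scalerA.
Qed.

HB.instance Definition _ :=
  GRing.isLinear.Build F (napoly F n) A *:%R napoly_eval napoly_eval_linear.

Fact napoly_evalU (c : F) (k : magma n) :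
  napoly_eval << c *g k >> = c *: magma_eval k.
Proof. by rewrite (napoly_evalw msuppU_le) big_seq_fset1 mcoeffUU. Qed.

Fact napoly_evalM : {morph napoly_eval : u v / u *a v >-> u *a v}.
Proof.
move=> u v; rewrite [u *a v]/(napoly_mul u v) /napoly_mul raddf_sum.
rewrite [in RHS]/napoly_eval linear_sumlz; apply: eq_bigr => k _.
rewrite raddf_sum [RHS]linear_sumr; apply: eq_bigr => l _ /=.
by rewrite napoly_evalU linearZl_LR linearZr_LR /= scalerA.
Qed.

End Evaluation.

Definition satisfies (F : fieldType) (A : nalgType F) (n : nat)
    (v : napoly F n) : Prop :=
  forall h : 'I_n -> A, napoly_eval h v = 0.

Definition is_identity (F : fieldType) (S : nalgType F -> Prop) (n : nat)
    (v : napoly F n) : Prop :=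
  forall A : nalgType F, S A -> satisfies A v.

Definition var (F : fieldType) (S : nalgType F -> Prop) (B : nalgType F) : Prop :=
  forall (n : nat) (v : napoly F n), is_identity S v -> satisfies B v.

Definition var1 (F : fieldType) (A : nalgType F) : nalgType F -> Prop :=
  var (fun B => B = A).

Definition proper_subalgs (F : fieldType) (A : nalgType F) (B : nalgType F) : Prop :=
  exists2 S : subalg A, proper_subalg S & B = (subalg_type S : nalgType F).

Section FreeAlgebra.
Variables (F : fieldType) (W : nalgType F -> Prop) (n : nat).

Definition identity_pred : {pred napoly F n} :=
  fun v => `[< is_identity W v >].

Fact identity_submod : submod_closed identity_pred.
Proof.
split; first by apply/asboolP=> A _ h; rewrite raddf0.
move=> c u v /asboolP uW /asboolP vW; apply/asboolP=> A AW h.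
by rewrite linearP /= uW // vW // scaler0 addr0.
Qed.

Fact identity_amull u :
  {in identity_pred, forall v, u *a v \in identity_pred}.
Proof.
move=> v /asboolP vW; apply/asboolP=> A AW h.
by rewrite napoly_evalM vW // linear0r.
Qed.

Fact identity_amulr v :
  {in identity_pred, forall u, u *a v \in identity_pred}.
Proof.
move=> u /asboolP uW; apply/asboolP=> A AW h.
by rewrite napoly_evalM uW // linear0l.
Qed.

Definition identity_ideal : ideal (napoly F n) :=
  Ideal identity_submod identity_amull identity_amulr.

Definition free_alg : nalgType F := quot_alg identity_ideal.

End FreeAlgebra.

(* Relatively free algebras are considered up to isomorphism.                 *)

Definition is_free (F : fieldType) (W : nalgType F -> Prop) (n : nat)
    (L : nalgType F) : Prop :=
  alg_iso L (free_alg W n).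

(* Main.v *)
(* C is a quotient of the free nonassociative algebra S on finitely many      *)
(* generators, which has finitely many homomorphisms f_t to A. The            *)
(* nonsurjective ones have proper images, and their common kernel K consists  *)
(* of the identities of U. A minimal set J of surjective f_j separating K     *)
(* modulo the identities of A splits K, modulo those, into a power of A, and  *)
(* the common kernel M of the f_j, j in J, is a complement lying in U. As in  *)
(* a semisimple module, a subfamily of the images of the factors A            *)
(* complements the image of M in C.                                           *)

Require Import Defs.
From HB Require Import structures.
From mathcomp Require Import all_boot all_algebra.
From mathcomp Require Import generic_quotient boolp cardinality monalg.

Set Implicit Arguments.
Unset Strict Implicit.
Unset Printing Implicit Defensive.

Import GRing.Theory.
Local Open Scope ring_scope.

(** Let [p] be a surjection onto [C] from the absolutely free algebra, killing the identities of
    [A]. As [A] is finite, there are finitely many evaluations f_t into [A], and [p] kills their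
    common kernel. The image of f_t is the subalgebra generated by the values of the variables, so
    the common kernel K of the nonsurjective f_t consists of the identities of the proper
    subalgebras ([proper_subalgs_identityP]). Simplicity of [A] and minimality of J give elements of
    K with a prescribed value under one f_j, j in J, and value 0 under the others. Hence p(K) is a
    sum of mutually annihilating images of [A], and with M the common kernel of the f_j and Q = p(M)
    one has C = p(K) + Q ([finite_separated_decomposition]). Some of these images complement Q
    ([power_complement]); their sum is P.

    Two facts conclude: [p] kills the intersection of M and K, and P lies in p(K). The first puts Q
    in U, since identities of U evaluated on M land in that intersection. For free [C], both
    together make the natural map from Q to the quotient by K bijective. *)

(** * Linear maps, ideals and isomorphisms *)

Lemma linear_structure (F : fieldType) (U W : lmodType F) (g : U -> W) :
  linear g -> exists g' : {linear U -> W}, g' =1 g.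
Proof.
move=> glin; pose m := GRing.isLinear.Build F U W *:%R g glin.
by pose g' : {linear U -> W} := HB.pack g m; exists g'.
Qed.

Lemma inj_surj_bijective (T T' : Type) (g : T -> T') :
  injective g -> (forall y, exists x, g x = y) -> bijective g.
Proof.
move=> ginj gsurj; exists (fun y => sval (cid (gsurj y))) => x.
  by apply: ginj; case: cid.
by case: cid.
Qed.

Lemma simple_ideal_full (F : fieldType) (A : nalgType F) (I : ideal A) (x : A) :
  simple_alg A -> x \in I -> x != 0 -> forall y, y \in I.
Proof.
move=> [_ Asimple] xI x0 y; apply/negP => /negP yI.
by case/eqP: x0; apply: Asimple xI; exists y.
Qed.

(** Ideals carry boolean predicates, while those of the proof are given by quantified formulas;
    classical reflection bridges the two. *)
Lemma prop_ideal (F : fieldType) (A : nalgType F) (R : A -> Prop) :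
  R 0 -> (forall c x y, R x -> R y -> R (c *: x + y)) ->
  (forall x y, R y -> R (x *a y)) -> (forall x y, R x -> R (x *a y)) ->
  exists I : ideal A, forall x, (x \in I) <-> R x.
Proof.
move=> R0 RP Rl Rr; pose p : {pred A} := fun x => `[< R x >].
have pP x : (x \in p) <-> R x by split=> /asboolP.
have ps : submod_closed p.
  by split=> [|c x y /pP Rx /pP Ry]; apply/pP => //; apply: RP.
have pl x : {in p, forall y, x *a y \in p} by move=> y /pP Ry; apply/pP/Rl.
have pr y : {in p, forall x, x *a y \in p} by move=> x /pP Rx; apply/pP/Rr.
by exists (Ideal ps pl pr).
Qed.

Lemma alg_iso_sym (F : fieldType) (A B : nalgType F) : alg_iso A B -> alg_iso B A.
Proof.
move=> [f [[g fK gK] fM]].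
have [g' g'E] := linear_structure (can2_linear fK gK).
exists g'; split; first by exists f => x; rewrite ?g'E ?fK // gK.
by move=> x y; rewrite !g'E -{1}[x]gK -{1}[y]gK -fM fK.
Qed.

(** * Complementing an ideal by copies of a simple algebra *)

(* For a minimal J0 with C = Q + sum_(j in J0) h_j(A), the preimage by h_j of  *)
(* Q + sum_(i in J0, i != j) h_i(A) is a proper ideal of A, hence zero.        *)
Lemma power_complement (F : fieldType) (A C : nalgType F) (T : finType)
    (J : {set T}) (h : T -> {linear A -> C}) (Q : ideal C) :
  simple_alg A ->
  (forall j, j \in J -> {morph h j : a b / a *a b}) ->
  (forall i j a b, i \in J -> j \in J -> i != j -> h i a *a h j b = 0) ->
  (forall j c, j \in J -> exists a', forall a, c *a h j a = h j (a' *a a)) ->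
  (forall j c, j \in J -> exists a', forall a, h j a *a c = h j (a *a a')) ->
  (forall c, exists2 q, q \in Q &
     exists a : T -> A, c = q + \sum_(j in J) h j (a j)) ->
  exists P : ideal C,
    [/\ is_direct_sum P Q,
        exists k : nat, alg_iso (subalg_type P) (power A 'I_k)
      & forall c, c \in P -> exists a : T -> A, c = \sum_(j in J) h j (a j)].
Proof.
move=> As hM h0 hl hr cov.
pose gen (K : {set T}) := `[< forall c, exists2 q, q \in Q &
     exists a : T -> A, c = q + \sum_(j in K) h j (a j) >].
have [J0 /minsetP[/asboolP genJ0 minJ0] sJ0] : {J0 : {set T} | minset gen J0 & J0 \subset J}.
  by apply: minset_exists; apply/asboolP.
have sub0 j : j \in J0 -> j \in J by apply: (subsetP sJ0).
have ind q a : q \in Q -> q + \sum_(j in J0) h j (a j) = 0 ->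
    forall j, j \in J0 -> a j = 0.
  move=> qQ qa0 j jJ0.
  have jJ := sub0 _ jJ0.
  pose R (b : A) := exists2 q, q \in Q &
    exists a : T -> A, h j b = q + \sum_(i in J0 :\ j) h i (a i).
  (* Distinct images annihilate each other, so a product with [h j b] only sees the component in
     [Q]; this is why [R] is closed under multiplication by [A]. *)
  have orth b q' a' : h j b *a (q' + \sum_(i in J0 :\ j) h i (a' i)) = h j b *a q'.
    rewrite linearDr linear_sumr [X in _ + X]big1 ?addr0 // => i.
    by rewrite !inE => /andP[ij iJ]; apply: h0 => //; [apply: sub0|rewrite eq_sym].
  have orth' b q' a' : (q' + \sum_(i in J0 :\ j) h i (a' i)) *a h j b = q' *a h j b.
    rewrite linearDl linear_sumlz [X in _ + X]big1 ?addr0 // => i.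
    by rewrite !inE => /andP[ij iJ]; apply: h0 => //; apply: sub0.
  have [||||B BE] := @prop_ideal F A R.
  - exists 0; first by rewrite rpred0.
    by exists (fun=> 0); rewrite raddf0 add0r big1 // => i _; rewrite raddf0.
  - move=> c x y [q1 q1Q [a1 E1]] [q2 q2Q [a2 E2]].
    exists (c *: q1 + q2); first by rewrite rpredD // rpredZ.
    exists (fun i => c *: a1 i + a2 i).
    under eq_bigr do rewrite linearP.
    by rewrite linearP E1 E2 /= big_split -scaler_sumr scalerDr /= addrACA.
  - move=> x y [q1 q1Q [a1 E1]]; exists (h j x *a q1); first exact: ideal_amull.
    exists (fun=> 0); rewrite hM // E1 orth big1 ?addr0 // => i _.
    by rewrite raddf0.
  - move=> x y [q1 q1Q [a1 E1]]; exists (q1 *a h j y); first exact: ideal_amulr.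
    exists (fun=> 0); rewrite hM // E1 orth' big1 ?addr0 // => i _.
    by rewrite raddf0.
  apply/eqP; apply: contraT => aj0.
  have ajB : a j \in B.
    apply/BE; exists (- q); first by rewrite rpredN.
    exists (fun i => - a i); move: qa0; rewrite (big_setD1 j) //= => /eqP.
    rewrite addrCA addr_eq0 => /eqP ->; rewrite opprD; congr (_ + _).
    by rewrite -sumrN; apply: eq_bigr => i _; rewrite raddfN.
  have Bfull := simple_ideal_full As ajB aj0.
  (* Now every [h j (a1 j)] can be rewritten through [Q] and the other images, so [j] is
     redundant. *)
  suff /minJ0 /(_ (subD1set _ _)) E : gen (J0 :\ j).
    by move: jJ0; rewrite -E !inE eqxx.
  apply/asboolP => c; have [q1 q1Q [a1 ->]] := genJ0 c.
  have /BE[q2 q2Q [a2 E2]] := Bfull (a1 j).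
  exists (q1 + q2); first by rewrite rpredD.
  exists (fun i => a2 i + a1 i); rewrite (big_setD1 j) //= E2.
  under [in RHS]eq_bigr do rewrite raddfD.
  by rewrite big_split /= !addrA.
pose RP (c : C) := exists a : T -> A, c = \sum_(j in J0) h j (a j).
have [||||P PE] := @prop_ideal F C RP.
- by exists (fun=> 0); rewrite big1 // => i _; rewrite raddf0.
- move=> c x y [a1 ->] [a2 ->]; exists (fun i => c *: a1 i + a2 i).
  under [in RHS]eq_bigr do rewrite linearP.
  by rewrite big_split -scaler_sumr.
- move=> x _ [a1 ->].
  have /choice[a' a'E] j : exists a', j \in J0 -> forall a, x *a h j a = h j (a' *a a).
    case: (boolP (j \in J0)) => [/sub0 jJ|_]; last by exists 0.
    by have [a' E] := hl j x jJ; exists a'.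
  exists (fun i => a' i *a a1 i); rewrite linear_sumr.
  by apply: eq_bigr => j jJ; apply: a'E.
- move=> _ x [a1 ->].
  have /choice[a' a'E] j : exists a', j \in J0 -> forall a, h j a *a x = h j (a *a a').
    case: (boolP (j \in J0)) => [/sub0 jJ|_]; last by exists 0.
    by have [a' E] := hr j x jJ; exists a'.
  exists (fun i => a1 i *a a' i); rewrite linear_sumlz.
  by apply: eq_bigr => j jJ; apply: a'E.
exists P; split.
- split=> [c|c /PE[a ->] aQ].
    have [q qQ [a ->]] := genJ0 c; exists (\sum_(j in J0) h j (a j)), q.
    by split=> //; [apply/PE; exists a|rewrite addrC].
  have := ind (- (\sum_(j in J0) h j (a j))) a; rewrite rpredN => /(_ aQ).
  rewrite addNr => /(_ erefl) a0.
  by rewrite big1 // => i /a0 ->; rewrite raddf0.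
- exists #|J0|; apply: alg_iso_sym.
  pose s (u : power A 'I_#|J0|) := \sum_(i < #|J0|) h (enum_val i) (u i).
  have extend (u : power A 'I_#|J0|) : exists a : T -> A, forall i, u i = a (enum_val i).
    (* Extension by zero off [J0]: as [enum_val] is injective, the sum has at most one term. *)
    exists (fun t => \sum_(i | enum_val i == t) u i) => i.
    rewrite (eq_bigl (pred1 i)) ?big_pred1_eq // => j /=.
    by apply/eqP/eqP => [/enum_val_inj|->].
  have sE (a : T -> A) : \sum_(j in J0) h j (a j) = s (fun i => a (enum_val i)).
    by rewrite (big_enum_val (fun j => h j (a j))).
  have slin : linear s.
    move=> c u v; rewrite /s scaler_sumr -big_split; apply: eq_bigr => i _ /=.
    exact: linearP.
  have sM : {morph s : u v / u *a v}.
    move=> u v; rewrite {2}/s linear_sumlz /s; apply: eq_bigr => i _.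
    rewrite linear_sumr (bigD1 i) //= big1 ?addr0 ?hM ?sub0 ?enum_valP //.
    move=> j ji; apply: h0; rewrite ?sub0 ?enum_valP //.
    by apply: contra ji => /eqP/enum_val_inj ->.
  have sP u : s u \in P.
    by apply/PE; have [a aE] := extend u; exists a; rewrite sE; congr s; apply/funext.
  pose f u : subalg_type P := SubalgElt (sP u).
  have flin : linear f by move=> c u v; apply: val_inj; apply: slin.
  have [f' f'E] := linear_structure flin.
  exists f'; split; last by move=> u v; rewrite !f'E; apply: val_inj; apply: sM.
  apply: inj_surj_bijective => [u v|[c cP]].
    rewrite !f'E => /(congr1 val) /= /eqP; rewrite -subr_eq0 => /eqP suv.
    have {suv} : s (u - v) = 0.
      have := slin (-1) v u; rewrite !scaleN1r [RHS]addrC suv => <-.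
      by rewrite addrC.
    have [a aE] := extend (u - v) => su0.
    apply/funext => i; apply/eqP; rewrite -subr_eq0; apply/eqP.
    have -> : u i - v i = (u - v) i by [].
    rewrite aE; apply: (ind 0); rewrite ?rpred0 ?enum_valP // add0r sE -su0.
    by congr s; apply/funext => k; rewrite aE.
  have /PE[a ca] := cP; exists (fun i => a (enum_val i)); rewrite f'E.
  by apply: val_inj; rewrite /= -sE.
move=> c /PE[a ->]; exists (fun j => if j \in J0 then a j else 0).
rewrite [RHS](big_setID J0) /= (setIidPr sJ0) [X in _ + X]big1 ?addr0.
  by apply: eq_bigr => j ->.
by move=> j; rewrite inE => /andP[/negPf -> _]; rewrite raddf0.
Qed.

(** * Separating families of homomorphisms onto a simple algebra *)

(* A minimal set J of surjective f_j separating what the nonsurjective ones   *)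
(* leave identified makes the surjective ones independent: each f_j maps the  *)
(* common kernel of all the others onto A.                                    *)
Lemma finite_separated_decomposition (F : fieldType) (A S C : nalgType F)
    (T : finType) (f : T -> {linear S -> A}) (p : {linear S -> C}) :
  simple_alg A ->
  (forall t, {morph f t : x y / x *a y}) -> {morph p : x y / x *a y} ->
  (forall c, exists s, p s = c) ->
  (forall s, (forall t, f t s = 0) -> p s = 0) ->
  let K s := forall t, ~ (forall a, exists s, f t s = a) -> f t s = 0 in
  exists P Q : ideal C, exists M : ideal S,
    [/\ is_direct_sum P Q /\ exists k : nat, alg_iso (subalg_type P) (power A 'I_k),
        forall c, c \in P -> exists2 s, K s & p s = c,
        forall q, q \in Q -> exists2 s, s \in M & p s = q
      & forall s, s \in M -> K s -> p s = 0].
Proof.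
move=> As fM pM psurj sep K.
pose separating (J : {set T}) :=
  `[< forall s, K s -> {in J, forall t, f t s = 0} -> p s = 0 >].
pose J1 := [set t | `[< forall a, exists s, f t s = a >]].
have [J /minsetP[/asboolP sepJ minJ] sJ] : {J : {set T} | minset separating J & J \subset J1}.
  apply: minset_exists; apply/asboolP => s Ks J1s; apply: sep => t.
  have [tJ1|] := boolP (t \in J1); first exact: J1s.
  by rewrite inE => /asboolP /Ks.
have fsurj j : j \in J -> forall a, exists s, f j s = a.
  by move/(fintype.subsetP sJ); rewrite inE => /asboolP.
have KP c x y : K x -> K y -> K (c *: x + y).
  by move=> Kx Ky t nt; rewrite linearP Kx // Ky // scaler0 addr0.
have Kl x y : K y -> K (x *a y) by move=> Ky t nt; rewrite fM Ky // linear0r.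
have Kr x y : K x -> K (x *a y) by move=> Kx t nt; rewrite fM Kx // linear0l.
(* Modulo the kernel of [p], such an [s] is unique ([dual_uniq]); sending [a] to [p s] will define
   [h j]. *)
pose dual j a s := [/\ K s, f j s = a & forall i, i \in J -> i != j -> f i s = 0].
have dual_ex j a : j \in J -> exists s, dual j a s.
  move=> jJ; pose R a := exists s, dual j a s.
  have [||||B BE] := @prop_ideal F A R.
  - by exists 0; split=> [t _||t _ _]; rewrite raddf0.
  - move=> c x y [s [Ks sx sJ0]] [s' [Ks' s'y s'J0]]; exists (c *: s + s').
    split=> [||i iJ ij]; first exact: KP.
      by rewrite linearP sx s'y.
    by rewrite linearP sJ0 // s'J0 // scaler0 addr0.
  - move=> x y [s [Ks sy sJ0]]; have [s' s'x] := fsurj j jJ x.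
    exists (s' *a s); split=> [||i iJ ij]; first exact: Kl.
      by rewrite fM s'x sy.
    by rewrite fM sJ0 // linear0r.
  - move=> x y [s [Ks sx sJ0]]; have [s' s'y] := fsurj j jJ y.
    exists (s *a s'); split=> [||i iJ ij]; first exact: Kr.
      by rewrite fM s'y sx.
    by rewrite fM sJ0 // linear0l.
  (* Without [j] the family no longer separates, which provides [s]. Then [f j s] is nonzero, since
     otherwise [sepJ] would give [p s = 0]; so the ideal of attained values is all of [A]. *)
  have [s [Ks sj ps]] : exists s, [/\ K s, {in J :\ j, forall t, f t s = 0} & p s != 0].
    apply: contrapT => nex.
    suff /minJ /(_ (subD1set _ _)) E : separating (J :\ j).
      by move: jJ; rewrite -E !inE eqxx.
    apply/asboolP => s Ks sj; apply/eqP; apply: contraT => ps.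
    by case: nex; exists s.
  have fs0 : f j s != 0.
    apply: contra ps => /eqP fs0; apply/eqP/sepJ => // t tJ.
    by have [->//|tj] := eqVneq t j; apply: sj; rewrite !inE tj.
  apply/BE; apply: (simple_ideal_full (x := f j s)) => //.
  apply/BE; exists s; split=> // i iJ ij.
  by apply: sj; rewrite !inE ij.
have dual_uniq j a s s' : j \in J -> dual j a s -> dual j a s' -> p s = p s'.
  move=> jJ [Ks sa s0] [Ks' s'a s'0].
  apply/eqP; rewrite -subr_eq0 -linearB; apply/eqP/sepJ.
    by rewrite addrC -scaleN1r; apply: KP.
  move=> t tJ; rewrite linearB.
  have [tj|tj] := eqVneq t j; first by rewrite tj sa s'a subrr.
  by rewrite s0 // s'0 // subrr.
have dual_lin j c a b s s' : dual j a s -> dual j b s' ->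
    dual j (c *: a + b) (c *: s + s').
  move=> [Ks sa s0] [Ks' s'a s'0]; split; first exact: KP.
    by rewrite linearP sa s'a.
  by move=> i iJ ij; rewrite linearP s0 // s'0 // scaler0 addr0.
have dual_l j a x s : dual j a s -> dual j (f j x *a a) (x *a s).
  move=> [Ks sa s0]; split; [exact: Kl|by rewrite fM sa|].
  by move=> i iJ ij; rewrite fM s0 // linear0r.
have dual_r j a x s : dual j a s -> dual j (a *a f j x) (s *a x).
  move=> [Ks sa s0]; split; [exact: Kr|by rewrite fM sa|].
  by move=> i iJ ij; rewrite fM s0 // linear0l.
have [h hE] : exists h : T -> {linear A -> C},
    forall j, j \in J -> forall a s, dual j a s -> h j a = p s.
  suff /choice[h hE] : forall j, exists hj : {linear A -> C},
    j \in J -> forall a s, dual j a s -> hj a = p s by exists h.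
  move=> j; have [jJ|_] := boolP (j \in J); last by exists \0.
  have /choice[g gE] a := dual_ex j a jJ.
  have glin : linear (p \o g).
    move=> c a b /=; rewrite -linearP; apply: (dual_uniq j _ _ _ jJ (gE _)).
    exact: dual_lin.
  have [g' g'E] := linear_structure glin.
  by exists g' => _ a s sa; rewrite g'E; apply: (dual_uniq j _ _ _ jJ (gE _)).
have [||||M ME] := @prop_ideal F S (fun s => {in J, forall j, f j s = 0}).
- by move=> j _; rewrite raddf0.
- by move=> c x y x0 y0 j jJ; rewrite linearP x0 // y0 // scaler0 addr0.
- by move=> x y y0 j jJ; rewrite fM y0 // linear0r.
- by move=> x y x0 j jJ; rewrite fM x0 // linear0l.
have [||||Q QE] := @prop_ideal F C (fun c => exists2 s, s \in M & p s = c).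
- by exists 0; rewrite ?rpred0 ?raddf0.
- move=> c x y [s sM <-] [s' s'M <-]; exists (c *: s + s'); last exact: linearP.
  by rewrite rpredD // rpredZ.
- move=> x y [s sM <-]; have [s' <-] := psurj x.
  by exists (s' *a s); [apply: ideal_amull|rewrite pM].
- move=> x y [s sM <-]; have [s' <-] := psurj y.
  by exists (s *a s'); [apply: ideal_amulr|rewrite pM].
have [|||||P [dPQ isoP Pgen]] := @power_complement F A C T J h Q As.
- move=> j jJ a b; have [[s sa] [s' s'b]] := (dual_ex j a jJ, dual_ex j b jJ).
  rewrite (hE j jJ _ _ sa) (hE j jJ _ _ s'b) -pM; apply: hE => //.
  by case: (sa) => _ <- _; apply: dual_l.
- move=> i j a b iJ jJ ij; have [[s sa] [s' s'b]] := (dual_ex i a iJ, dual_ex j b jJ).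
  rewrite (hE i iJ _ _ sa) (hE j jJ _ _ s'b) -pM.
  have := dual_l j b s s' s'b; case: sa => _ _ /(_ j jJ) ->; last by rewrite eq_sym.
  by rewrite linear0l => /(hE j jJ) <-; rewrite raddf0.
(* The element [p s] acts on the image of [h j] as [f j s] acts on [A]. *)
- move=> j c jJ; have [s <-] := psurj c; exists (f j s) => a.
  have [s' s'a] := dual_ex j a jJ.
  by rewrite (hE j jJ _ _ s'a) -pM; apply/esym/hE => //; apply: dual_l.
- move=> j c jJ; have [s <-] := psurj c; exists (f j s) => a.
  have [s' s'a] := dual_ex j a jJ.
  by rewrite (hE j jJ _ _ s'a) -pM; apply/esym/hE => //; apply: dual_r.
- move=> c; have [s <-] := psurj c.
  have /choice[g gE] j : exists g, j \in J -> dual j (f j s) g.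
    have [jJ|_] := boolP (j \in J); last by exists 0.
    by have [g] := dual_ex j (f j s) jJ; exists g.
  (* Subtracting dual elements with the same values as [s] leaves an element of [M]. *)
  exists (p (s - \sum_(j in J) g j)); last first.
    exists (fun j => f j s); rewrite linearB linear_sum.
    rewrite [X in _ = _ - _ + X](eq_bigr (fun j => p (g j))) ?subrK //.
    by move=> j jJ; apply: hE => //; apply: gE.
  apply/QE; exists (s - \sum_(j in J) g j) => //; apply/ME => j jJ.
  rewrite linearB linear_sum (bigD1 j) //= big1 => [|i /andP[iJ ij]].
    by rewrite addr0; case: (gE j jJ) => _ -> _; rewrite subrr.
  by case: (gE i iJ) => _ _; apply; rewrite // eq_sym.
exists P, Q, M; split=> //; last first.
- by move=> s /ME s0 Ks; apply: sepJ.
- by move=> q /QE.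
move=> c /Pgen[a ->].
have /choice[g gE] j : exists g, j \in J -> dual j (a j) g.
  have [jJ|_] := boolP (j \in J); last by exists 0.
  by have [g] := dual_ex j (a j) jJ; exists g.
exists (\sum_(j in J) g j).
  move=> t nt; rewrite linear_sum big1 // => j jJ.
  by case: (gE j jJ) => Kg _ _; apply: Kg.
rewrite linear_sum; apply: eq_bigr => j jJ.
by apply/esym/hE => //; apply: gE.
Qed.

(** * Evaluations and the identities of proper subalgebras *)

Lemma napoly_eval_mem (F : fieldType) (A : nalgType F) (S : subalg A) (n : nat)
    (h : 'I_n -> A) (v : napoly F n) :
  (forall i, h i \in S) -> napoly_eval h v \in S.
Proof.
move=> hS; apply: rpred_sum => m _; apply: rpredZ.
by elim: m => [i|k IHk l IHl] //=; apply: subalg_amul.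
Qed.

Lemma napoly_eval_morph (F : fieldType) (A B : nalgType F)
    (g : {linear A -> B}) (n : nat) (h : 'I_n -> A) (v : napoly F n) :
  {morph g : x y / x *a y} -> g (napoly_eval h v) = napoly_eval (g \o h) v.
Proof.
move=> gM; rewrite linear_sum; apply: eq_bigr => m _; rewrite linearZ /=.
by congr (_ *: _); elim: m => [i|k IHk l IHl] //=; rewrite gM IHk IHl.
Qed.

Lemma napoly_eval_val (F : fieldType) (A : nalgType F) (S : subalg A) (n : nat)
    (h : 'I_n -> subalg_type S) (v : napoly F n) :
  val (napoly_eval h v) = napoly_eval (val \o h) v.
Proof. exact: (napoly_eval_morph (g := (\val : {linear subalg_type S -> A}))). Qed.

Lemma napoly_eval_var (F : fieldType) (A : nalgType F) (n : nat)
    (h : 'I_n -> A) (i : 'I_n) : napoly_eval h << 1 *g MVar i >> = h i.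
Proof. by rewrite napoly_evalU scale1r. Qed.

(** The values at [h] of all polynomials form the subalgebra generated by [h], so [h] takes its
    values in some proper subalgebra exactly when evaluation at [h] is not onto. *)
Lemma proper_subalgs_identityP (F : fieldType) (A : nalgType F) (n : nat)
    (v : napoly F n) :
  is_identity (proper_subalgs A) v <->
  forall h : 'I_n -> A, ~ (forall a, exists w, napoly_eval h w = a) ->
    napoly_eval h v = 0.
Proof.
split=> [idv h nsurj|idv B [S [x xS] ->] h].
  pose p : {pred A} := fun a => `[< exists w, napoly_eval h w = a >].
  have pP a : (a \in p) <-> exists w, napoly_eval h w = a by split=> /asboolP.
  have ps : submod_closed p.
    split=> [|c _ _ /pP[w <-] /pP[w' <-]]; apply/pP.
      by exists 0; rewrite raddf0.
    by exists (c *: w + w'); rewrite linearP.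
  have pm : {in p &, forall x y, x *a y \in p}.
    move=> _ _ /pP[w <-] /pP[w' <-]; apply/pP; exists (w *a w').
    exact: napoly_evalM.
  pose S := Subalg ps pm.
  have hp i : h i \in S.
    by apply/pP; exists << 1 *g MVar i >>; apply: napoly_eval_var.
  have Sproper : proper_subalg S.
    apply: contrapT => nS; apply: nsurj => a; apply/pP; apply: contrapT => /negP.
    by move=> aS; apply: nS; exists a.
  have := idv _ (ex_intro2 _ _ S Sproper erefl) (fun i => SubalgElt (hp i)).
  by move/(congr1 val); rewrite napoly_eval_val.
apply: val_inj; rewrite napoly_eval_val //= idv // => surj.
have [w wx] := surj x; case/negP: xS; rewrite -wx.
by apply: napoly_eval_mem => i; apply: valP.
Qed.

Lemma var1_identityP (F : fieldType) (A : nalgType F) (n : nat) (v : napoly F n) :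
  is_identity (var1 A) v <-> satisfies A v.
Proof.
split=> [|sv B AB]; first by apply=> m w; apply.
by apply: AB => _ ->.
Qed.

(** * Decomposition of finite and of free algebras in the variety *)

Lemma finite_alg_seq (F : fieldType) (A : nalgType F) :
  finite_alg A -> exists s : seq A, forall a, a \in s.
Proof.
move=> /finite_seqP[s sE]; exists s => a.
by have : @classical_sets.setT A a by []; rewrite sE.
Qed.

Lemma finite_assignments (F : fieldType) (A : nalgType F) (n : nat) :
  finite_alg A ->
  exists (T : finType) (h : T -> 'I_n -> A), forall g, exists t, h t = g.
Proof.
move=> /finite_alg_seq[s sA].
exists {ffun 'I_n -> 'I_(size s)}, (fun (t : {ffun 'I_n -> 'I_(size s)}) i => s`_(t i)) => g.
have gs i : (index (g i) s < size s)%N by rewrite index_mem.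
exists [ffun i => Ordinal (gs i)]; apply/funext => i.
by rewrite ffunE /= nth_index.
Qed.

(** The family of homomorphisms is that of all evaluations at tuples of [A]: vanishing under all of
    them means being an identity of [A], and under the nonsurjective ones, an identity of the proper
    subalgebras. *)
Lemma variety_decomposition (F : fieldType) (A C : nalgType F) (n : nat)
    (p : {linear napoly F n -> C}) :
  finite_alg A -> simple_alg A -> {morph p : x y / x *a y} ->
  (forall c, exists s, p s = c) -> (forall s, satisfies A s -> p s = 0) ->
  exists P Q : ideal C, exists M : ideal (napoly F n),
    [/\ is_direct_sum P Q /\ exists k : nat, alg_iso (subalg_type P) (power A 'I_k),
        forall c, c \in P -> exists2 s, is_identity (proper_subalgs A) s & p s = c,
        forall q, q \in Q -> exists2 s, s \in M & p s = q
      & forall s, s \in M -> is_identity (proper_subalgs A) s -> p s = 0].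
Proof.
move=> Afin As pM psurj pV.
have [T [h hsurj]] := finite_assignments n Afin.
pose f t : {linear napoly F n -> A} := napoly_eval (h t).
have KE s : is_identity (proper_subalgs A) s <->
    forall t, ~ (forall a, exists w, f t w = a) -> f t s = 0.
  rewrite proper_subalgs_identityP; split=> [Ks t|Ks g]; first exact: Ks.
  by have [t <-] := hsurj g; apply: Ks.
have [||||P [Q [M [dPQ PK QM MK]]]] := @finite_separated_decomposition F A _ C T f p As.
- by move=> t; apply: napoly_evalM.
- exact: pM.
- exact: psurj.
- by move=> s fs; apply: pV => g; have [t <-] := hsurj g; apply: fs.
exists P, Q, M; split=> // [c /PK[s Ks <-]|s sM Ks].
  by exists s => //; apply/KE.
by apply: MK => //; apply/KE.
Qed.

Lemma free_alg_presentation (F : fieldType) (W : nalgType F -> Prop) (n : nat)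
    (L : nalgType F) :
  is_free W n L ->
  exists p : {linear napoly F n -> L},
    [/\ {morph p : x y / x *a y}, forall c, exists s, p s = c
      & forall s, p s = 0 <-> is_identity W s].
Proof.
move/alg_iso_sym => [g [[g' gK g'K] gM]].
pose I := identity_ideal W n.
pose pi (s : napoly F n) : free_alg W n := (\pi_(quot_alg I) s)%qT.
have pilin : linear pi.
  move=> c x y; rewrite /pi raddfD; congr (_ + _); exact: pi_quot_scale.
have piM : {morph pi : x y / x *a y} by move=> x y; apply: pi_quot_mul.
have glin : linear (g \o pi) by move=> c x y /=; rewrite pilin linearP.
have [p pE] := linear_structure glin.
exists p; split=> [x y|c|s]; rewrite ?pE /= ?piM ?gM //.
  by exists (repr (g' c : quot_alg I)); rewrite pE /= /pi reprK g'K.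
have pi0 : pi 0 = 0 by apply: raddf0.
have piP : pi s = 0 <-> is_identity W s.
  rewrite -pi0; split=> [/quot_eqP|Is]; rewrite ?subr0; first by move/asboolP.
  by apply/quot_eqP; rewrite subr0; apply/asboolP.
rewrite -piP; split=> [|->]; last exact: raddf0.
by rewrite -[X in _ = X](raddf0 g) => /(can_inj gK).
Qed.

Theorem theorem7 (F : fieldType) (A : nalgType F) :
  finite_alg A -> simple_alg A ->
  let V := var1 A in
  let U := var (proper_subalgs A) in
  (forall C : nalgType F, finite_alg C -> V C ->
     exists P Q : ideal C,
       [/\ is_direct_sum P Q,
           exists k : nat, alg_iso (subalg_type P) (power A 'I_k)
         & U (subalg_type Q)])
  /\
  (forall (n : nat) (L : nalgType F), is_free V n L ->
     exists P Q : ideal L,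
       [/\ is_direct_sum P Q,
           exists I : Type, alg_iso (subalg_type P) (power A I)
         & is_free U n (subalg_type Q)]).
Proof.
move=> Afin As V U; split=> [C /finite_alg_seq[c cC] VC|n L Lfree].
  (* The variables run through an enumeration of [C], so each element is already the value of a
     variable. *)
  pose p : {linear napoly F (size c) -> C} := napoly_eval (fun i => nth 0 c i).
  have pM : {morph p : x y / x *a y} by apply: napoly_evalM.
  have psurj x : exists s, p s = x.
    have xc : (index x c < size c)%N by rewrite index_mem.
    exists << 1 *g MVar (Ordinal xc) >>.
    by apply: etrans (napoly_eval_var _ _) _; rewrite /= nth_index.
  have pV s : satisfies A s -> p s = 0 by move=> As0; apply: VC => _ ->.
  have [P [Q [M [[dPQ isoP] _ QM MK]]]] := variety_decomposition Afin As pM psurj pV.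
  exists P, Q; split=> // r v idv q; apply: val_inj.
  rewrite napoly_eval_val //=.
  have /choice[m mE] i : exists s, s \in M /\ p s = val (q i).
    by have [s] := QM _ (valP (q i)); exists s.
  have -> : val \o q = p \o m by apply/funext => i /=; case: (mE i).
  (* The polynomial [napoly_eval m v] lies in [M]. It is also an identity of the proper subalgebras:
     evaluating it at [g] evaluates [v] at [napoly_eval g \o m], whose generated subalgebra lies in
     that of [g]. *)
  rewrite -napoly_eval_morph //; apply: MK.
    by apply: napoly_eval_mem => i; case: (mE i).
  apply/proper_subalgs_identityP => g nsurj; rewrite napoly_eval_morph; last first.
    exact: napoly_evalM.
  move/proper_subalgs_identityP: idv; apply => surj; apply: nsurj => a.
  have [w wa] := surj a; exists (napoly_eval m w); rewrite -wa.
  by apply: napoly_eval_morph; apply: napoly_evalM.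
have [p [pM psurj pV]] := free_alg_presentation Lfree.
have pker s : satisfies A s -> p s = 0 by move=> ?; apply/pV/var1_identityP.
have [P [Q [M [[dPQ [k isoP]] PK QM MK]]]] := variety_decomposition Afin As pM psurj pker.
exists P, Q; split=> //; first by exists 'I_k.
pose I := identity_ideal U n.
have UE s : is_identity (proper_subalgs A) s <-> s \in I.
  split=> [ids|/asboolP idU B AB]; first by apply/asboolP => B; apply.
  by apply: idU => m v; apply.
have kerI s : p s = 0 -> s \in I.
  move/pV/var1_identityP => sA; apply/UE/proper_subalgs_identityP => g _.
  exact: sA.
have /choice[l lE] (q : subalg_type Q) : exists s, p s = val q by [].
(* The choice of preimage is immaterial, because the kernel of [p] consists of identities of [A],
   which lie in [I]. *)
pose g (q : subalg_type Q) : free_alg U n := (\pi_(quot_alg I) (l q))%qT.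
have gE q s : p s = val q -> g q = (\pi_(quot_alg I) s)%qT.
  by move=> sq; apply/quot_eqP/kerI; rewrite linearB lE sq subrr.
have glin : linear g.
  move=> c x y; rewrite (gE _ (c *: l x + l y)); last by rewrite linearP !lE.
  by rewrite raddfD; congr (_ + _); apply: pi_quot_scale.
have [g' g'E] := linear_structure glin.
exists g'; split; last first.
  move=> x y; rewrite !g'E (gE _ (l x *a l y)); last by rewrite pM !lE.
  exact: pi_quot_mul.
apply: inj_surj_bijective => [x y|z].
  move=> gxy; apply/eqP; rewrite -subr_eq0 -(inj_eq val_inj) /=.
  (* Injectivity: a preimage taken in [M] that also lies in [I] is killed by [p]. *)
  have [s sM sxy] := QM _ (valP (x - y)).
  rewrite -[_ - _]sxy MK //; apply/UE; rewrite -[s]subr0; apply/quot_eqP.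
  by rewrite -(gE _ _ sxy) -g'E linearB gxy subrr [RHS]raddf0.
(* Surjectivity: the component in [P] comes from some [s] in [I]; subtracting [s] from a
   representative of [z] keeps its class and leaves a preimage of [q]. *)
have [a [q [aP qQ pz]]] := dPQ.1 (p (repr (z : quot_alg I))).
have [s Ks sa] := PK _ aP; exists (SubalgElt qQ).
rewrite g'E (gE _ (repr (z : quot_alg I) - s)) /=.
  rewrite -[RHS]reprK; apply/quot_eqP.
  by rewrite addrC addKr rpredN; apply/UE.
by rewrite linearB pz sa addrC addKr.
Qed.
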